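(* Let $S$ be a semigroup and let $\mathbb{N}=\{1,2,3,\dots\}$ be the additive semigroup of positive integers. Then: (1) $\mathbb{N}\times S$ is completely separable if and only if $S$ is completely separable; (2) $\mathbb{N}\times S$ is weakly subsemigroup separable but not strongly subsemigroup separable if and only if $S$ is residually finite but not completely separable; (3) $\mathbb{N}\times S$ is not residually finite if and only if $S$ is not residually finite.
   Context: Semigroups are nonempty; $S\times T$ is the direct product with componentwise multiplication. For a semigroup $S$, an element $s\in S$ and a subset $Y\subseteq S\setminus\{s\}$, we say $s$ can be separated from $Y$ if there exist a finite semigroup $P$ and a semigroup homomorphism $\phi:S\to P$ with $\phi(s)\notin\phi(Y)$ (equivalently, there is a congruence on $S$ with finitely many classes such that the class of $s$ contains no element of $Y$). A semigroup $S$ is: residually finite if every $s\in S$ can be separated from every singleton $\{y\}$ with $y\in S$, $y\neq s$; weakly subsemigroup separable if every $s\in S$ can be separated from every finitely generated subsemigroup $Y\subseteq S\setminus\{s\}$; strongly subsemigroup separable if every $s\in S$ can be separated from every subsemigroup $Y\subseteq S\setminus\{s\}$; completely separable if every $s\in S$ can be separated from every subset $Y\subseteq S\setminus\{s\}$. *)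

(* Defs.v *)
From HB Require Import structures.
From mathcomp Require Import all_boot.
From mathcomp Require Import boolp classical_sets cardinality.

Set Implicit Arguments.
Unset Strict Implicit.
Unset Printing Implicit Defensive.

Local Open Scope classical_set_scope.
Local Open Scope group_scope.

(* The additive semigroup {1, 2, 3, ...}: its operation, written [*] in
   [group_scope] like that of any [semigroupType], is the addition of [nat]. *)
Definition posnat : Type := {n : nat | (0 < n)%N}.

HB.instance Definition _ := Choice.on posnat.

Lemma posnat_add_subproof (m n : posnat) : (0 < val m + val n)%N.
Proof. by rewrite addn_gt0 (valP m). Qed.

Definition posnat_add (m n : posnat) : posnat :=
  exist _ (val m + val n)%N (posnat_add_subproof m n).

Lemma posnat_addA : associative posnat_add.
Proof. by move=> m n p; apply: val_inj; rewrite /= addnA. Qed.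

HB.instance Definition _ := isSemigroup.Build posnat posnat_addA.

Section Separability.
Variable S : semigroupType.
Implicit Types (s : S) (X Y : set S).

Definition separable_from s Y : Prop :=
  exists (P : semigroupType) (phi : {multiplicative S -> P}),
    finite_set [set: P] /\ ~ (phi @` Y) (phi s).

Definition subsemigroup Y : Prop :=
  Y !=set0 /\ (forall x y, Y x -> Y y -> Y (x * y)).

(* [X] is required to be nonempty because [smallest subsemigroup set0] is the
   intersection of all subsemigroups, which need not be one. *)
Definition fg_subsemigroup Y : Prop :=
  exists X, [/\ finite_set X, X !=set0 & Y = smallest subsemigroup X].

Definition residually_finite : Prop :=
  forall s y, y <> s -> separable_from s [set y].

Definition weakly_subsemigroup_separable : Prop :=
  forall s Y, fg_subsemigroup Y -> ~ Y s -> separable_from s Y.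

Definition strongly_subsemigroup_separable : Prop :=
  forall s Y, subsemigroup Y -> ~ Y s -> separable_from s Y.

Definition completely_separable : Prop :=
  forall s Y, ~ Y s -> separable_from s Y.

End Separability.

Arguments residually_finite S : clear implicits.
Arguments weakly_subsemigroup_separable S : clear implicits.
Arguments strongly_subsemigroup_separable S : clear implicits.
Arguments completely_separable S : clear implicits.

(* Main.v *)
(* Elements of {1, 2, 3, ...} below a given bound are recognised by the finite
   truncation k |-> min(k, n + 1), so separating (n, s) from Y in N x S reduces
   to separating s from the fibre of Y over n.  When Y is finitely generated
   this fibre is finite, because an element over n is a product of at most n
   generators; a finite fibre is separated using residual finiteness alone.
   Conversely, a separation of (3, s) from {3} x Y yields one of s from Y: the
   relation "phi (3, u a v) = phi (3, u b v) for all u, v in S^1" is a congruence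
   on S, and it has finite index because phi (3, u a v) splits as
   phi (1, u) phi (1, a) phi (1, v), so that it is determined by the values of
   phi at (1, a), (2, a) and (3, a).  Finally {3} x Y together with all elements
   over k > 3 is a subsemigroup of N x S, so strong subsemigroup separability of
   N x S already gives complete separability of S. *)
Require Import Defs.
From HB Require Import structures.
From mathcomp Require Import all_boot.
From mathcomp Require Import boolp classical_sets cardinality.
From mathcomp Require Import zify.

Set Implicit Arguments.
Unset Strict Implicit.
Unset Printing Implicit Defensive.

Local Open Scope classical_set_scope.
Local Open Scope group_scope.

(** The quotient of [S] by the congruence [R] does the separating. The map [f] only bounds the index
    of [R] and may fail to be multiplicative. *)
Lemma separable_from_congruence (S : semigroupType) (s : S) (Y : set S)
    (R : S -> S -> Prop) (T : Type) (f : S -> T) :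
  (forall a, R a a) -> (forall a b, R a b -> R b a) ->
  (forall a b c, R a b -> R b c -> R a c) ->
  (forall a b c d, R a b -> R c d -> R (a * c) (b * d)) ->
  finite_set [set: T] -> (forall a b, f a = f b -> R a b) ->
  (forall y, Y y -> ~ R y s) -> separable_from s Y.
Proof.
move=> Rxx Rsym Rtrans RM finT fR YR.
(* The quotient is carried by canonical representatives, that is, by the fixed points of [repr]. *)
pose repr a := xget a (R a).
have R_repr a : R a (repr a) by apply: xgetPex; exists a.
have repr_eq a b : R a b -> repr a = repr b.
  move=> Rab; have eqR : R a = R b.
    apply/funext => c; apply/propext; split; last exact: Rtrans.
    exact/Rtrans/Rsym.
  (* The two [xget] have different defaults [a] and [b]; neither is reached, since [b] itself
     satisfies [R b]. *)
  rewrite /repr /xget eqR; case: pselect => // -[].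
  by exists b; exact/asboolP.
have repr_id a : repr (repr a) == repr a.
  by apply/eqP/esym/repr_eq.
pose Q : choiceType := {x : S | repr x == x}.
pose cls a : Q := exist _ (repr a) (repr_id a).
pose mulQ (x y : Q) : Q := cls (val x * val y).
have clsM a b : cls (a * b) = mulQ (cls a) (cls b).
  by apply: val_inj; apply: repr_eq; apply: RM; exact: R_repr.
have clsK (x : Q) : cls (val x) = x by apply: val_inj; exact/eqP/(valP x).
have mulQA : associative mulQ.
  move=> x y z; rewrite -(clsK x) -(clsK y) -(clsK z).
  by rewrite -!clsM mulgA.
pose P : semigroupType := HB.pack_for semigroupType Q (isSemigroup.Build Q mulQA).
pose phi_mul := isMultiplicative.Build S P cls clsM.
pose phi : {multiplicative S -> P} := HB.pack_for {multiplicative S -> P} cls phi_mul.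
exists P, phi; split.
  (* [f] is injective on representatives: equal values make them related, hence equal. *)
  rewrite -(preimage_setT (fun x : Q => f (val x))).
  apply: finite_preimage finT => x y _ _ /fR Rxy.
  by rewrite -(clsK x) -(clsK y); apply: val_inj; exact: repr_eq.
move=> [y Yy /(congr1 val) /= eq_ys]; apply: (YR y Yy).
by apply: Rtrans (R_repr y) _; rewrite eq_ys; exact: Rsym.
Qed.

Lemma separable_from_kernel (S : semigroupType) (s : S) (Y : set S)
    (T : Type) (f : S -> T) :
  finite_set [set: T] ->
  (forall a b c d, f a = f b -> f c = f d -> f (a * c) = f (b * d)) ->
  (forall y, Y y -> f y <> f s) -> separable_from s Y.
Proof.
move=> finT fM Ys.
apply: (@separable_from_congruence _ _ _ (fun a b => f a = f b) _ f) => //.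
by move=> a b c -> ->.
Qed.

Lemma finite_setXTT (T U : Type) :
  finite_set [set: T] -> finite_set [set: U] -> finite_set [set: T * U].
Proof. by rewrite -setXTT; exact: finite_setX. Qed.

Section SeparableFrom.
Variables (S : semigroupType) (s : S).

Lemma separable_from_sub (Y Z : set S) :
  Y `<=` Z -> separable_from s Z -> separable_from s Y.
Proof.
move=> YZ [P [phi [finP Zs]]]; exists P, phi; split=> // -[y /YZ Zy eq_ys].
by apply: Zs; exists y.
Qed.

Lemma separable_from0 : separable_from s set0.
Proof. by apply: (@separable_from_kernel _ _ _ unit (fun=> tt)). Qed.

Lemma separable_fromU (Y Z : set S) :
  separable_from s Y -> separable_from s Z -> separable_from s (Y `|` Z).
Proof.
move=> [P [phi [finP Ys]]] [Q [psi [finQ Zs]]].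
apply: (@separable_from_kernel _ _ _ (P * Q) (fun a => (phi a, psi a))).
- exact: finite_setXTT.
- by move=> a b c d [ab ab'] [cd cd']; rewrite !gmulfM ab ab' cd cd'.
- by move=> y [Yy|Zy] [ys ys']; [apply: Ys|apply: Zs]; exists y.
Qed.

Lemma residually_finite_separable (Y : set S) :
  residually_finite S -> finite_set Y -> ~ Y s -> separable_from s Y.
Proof.
move=> rf /finite_seqP[r ->].
elim: r => [|y r IHr] Ns; first exact: separable_from_sub separable_from0.
apply: (@separable_from_sub _ ([set y] `|` [set` r])).
  by move=> z /=; rewrite inE => /orP[/eqP|]; [left|right].
apply: separable_fromU.
  by apply: rf => eq_ys; apply: Ns; rewrite /= eq_ys mem_head.
by apply: IHr => rs; apply: Ns; rewrite /= inE rs orbT.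
Qed.

End SeparableFrom.

Lemma separable_from_fibre (S : semigroupType) (n : posnat) (s : S)
    (Y : set (posnat * S)) :
  separable_from s [set a | Y (n, a)] -> separable_from (n, s) Y.
Proof.
move=> [P [phi [finP Ys]]].
(* Capping at [n + 1] rather than [n] keeps [n] apart from all larger integers. *)
pose trunc k : 'I_(val n).+2 := inord (minn k (val n).+1).
have val_trunc k : val (trunc k) = minn k (val n).+1.
  by rewrite /= inordK // ltnS geq_minr.
apply: (@separable_from_kernel _ _ _ ('I_(val n).+2 * P)
  (fun x : posnat * S => (trunc (val x.1), phi x.2))).
- exact: finite_setXTT.
- move=> [k a] [l b] [k' a'] [l' b'] [/(congr1 val) + ab] [/(congr1 val) + ab'].
  rewrite !val_trunc /= => kl kl'; rewrite !gmulfM ab ab'; congr (_, _).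
  by apply: val_inj; rewrite !val_trunc /=; lia.
- move=> [k a] Yka [/(congr1 val) + eq_as]; rewrite !val_trunc /= => eq_kn.
  have kn : k = n by apply: val_inj => /=; lia.
  by apply: Ys; exists a => //; rewrite /= -kn.
Qed.

Definition one : posnat := exist _ 1%N isT.
Definition three : posnat := one * one * one.

Lemma separable_from_fibre3 (S : semigroupType) (s : S) (Y : set S) :
  separable_from (three, s) [set x | x.1 = three /\ Y x.2] ->
  separable_from s Y.
Proof.
move=> [P [phi [finP Ys]]].
pose p (k : posnat) (a : S) := phi (k, a).
have pM k l a b : p (k * l) (a * b) = p k a * p l b by rewrite /p -gmulfM.
(* The four clauses spell out contexts [u], [v] in S^1, each of which may be absent. *)
apply: (@separable_from_congruence _ _ _ (fun a b =>
    [/\ p three a = p three b,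
        forall u, p three (u * a) = p three (u * b),
        forall v, p three (a * v) = p three (b * v)
      & forall u v, p three (u * a * v) = p three (u * b * v)]) _
    (fun a => (p one a, p (one * one) a, p three a))) => //.
- by move=> a b [e eL eR eLR]; split.
- move=> a b c [e eL eR eLR] [e' eL' eR' eLR']; split.
  + exact: etrans e'.
  + by move=> u; rewrite eL.
  + by move=> v; rewrite eR.
  + by move=> u v; rewrite eLR.
(* First [a] becomes [b] with [c] absorbed into the right context, then [c] becomes [d] with [b]
   absorbed into the left one. *)
- move=> a b c d [_ _ eR eLR] [_ eL' _ eLR']; split.
  + by rewrite eR eL'.
  + by move=> u; rewrite !mulgA eLR -!mulgA mulgA eL' mulgA.
  + by move=> v; rewrite -!mulgA eR !mulgA eLR'.
  + by move=> u v; rewrite !mulgA -(mulgA (u * a)) eLR !mulgA eLR'.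
- by do 2?apply: finite_setXTT.
(* Each context factor takes a [one] out of [three], leaving [a] over 2 for a one-sided context and
   over 1 for a two-sided one. *)
- move=> a b [e1 e2 e3]; split=> // [u|v|u v].
  + by rewrite /three -mulgA !pM e2.
  + by rewrite /three !pM e2.
  + by rewrite /three !pM e1.
- by move=> y Yy [e3 _ _ _]; apply: Ys; exists (three, y).
Qed.

Lemma finite_fibre_fg (S : semigroupType) (Y : set (posnat * S)) (n : posnat) :
  fg_subsemigroup Y -> finite_set [set a | Y (n, a)].
Proof.
move=> [X [finX X0 ->]]; set G := smallest _ X.
have GM x y : G x -> G y -> G (x * y).
  move=> Gx Gy Z CZ; have [[_ ZM] _] := CZ.
  by apply: ZM; [exact: Gx|exact: Gy].
(* The right-hand side is a subsemigroup containing [X], so it contains [G] by minimality. *)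
have G_dec : G `<=` X `|` [set x * y | x in G & y in G].
  have XG : X `<=` G by exact: sub_gen_smallest.
  have sub : X `|` [set x * y | x in G & y in G] `<=` G.
    by move=> _ [/XG//|[x Gx [y Gy <-]]]; exact: GM.
  apply: smallest_sub; last by move=> x; left.
  split; first by have [x Xx] := X0; exists x; left.
  by move=> x y /sub Gx /sub Gy; right; exists x => //; exists y.
(* Strong induction on [n]: as all integers here are positive, both factors of a product over [n]
   lie over smaller ones. *)
have [m] := ubnP (val n); elim: m n => // m IHm n le_nm.
pose F k := [set a | G (k, a)].
pose below : set posnat := [set i | (val i < val n)%N].
have fin_below : finite_set below.
  apply: (@finite_preimage _ _ `I_(val n) val) => // i j _ _.
  exact: val_inj.
apply: (@sub_finite_set _ _ (snd @` X `|`
    \bigcup_(i in below) \bigcup_(j in below) [set a * b | a in F i & b in F j])).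
  move=> a /= /G_dec[Xa|[[i b] Gb [[j c] Gc [eq_n eq_a]]]].
    by left; exists (n, a).
  have := valP j; have := valP i; rewrite /= => i0 j0; right.
  exists i; first by rewrite /below /= -eq_n /=; lia.
  exists j; first by rewrite /below /= -eq_n /=; lia.
  by exists b => //; exists c.
rewrite finite_setU; split; first exact: finite_image.
apply: bigcup_finite => // i i_n; apply: bigcup_finite => // j j_n.
by apply: finite_image2; apply: IHm; [exact: leq_trans i_n _|exact: leq_trans j_n _].
Qed.

(** A product of two members lies over at least 6, so [Y] can be arbitrary. The point [s] gives a
    member over 4 even when [Y] is empty. *)
Lemma subsemigroup_over3 (S : semigroupType) (s : S) (Y : set S) :
  subsemigroup [set x : posnat * S |
    (val x.1 > 3)%N \/ x.1 = three /\ Y x.2].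
Proof.
split; first by exists (three * one, s); left.
have ge3 (x : posnat * S) :
    (val x.1 > 3)%N \/ x.1 = three /\ Y x.2 -> (val x.1 >= 3)%N.
  by case=> [|[-> _]//]; exact: ltnW.
by move=> x y /ge3 /= x3 /ge3 /= y3; left; rewrite /=; lia.
Qed.

Lemma completely_separable_strongly (S : semigroupType) :
  completely_separable S -> strongly_subsemigroup_separable S.
Proof. by move=> cs s Y _; exact: cs. Qed.

Lemma completely_separable_posnatX (S : semigroupType) :
  completely_separable S -> completely_separable (posnat * S)%type.
Proof. by move=> cs [n s] Y Ns; apply: separable_from_fibre; exact: cs. Qed.

Lemma strongly_posnatX_completely_separable (S : semigroupType) :
  strongly_subsemigroup_separable (posnat * S)%type -> completely_separable S.
Proof.
move=> sss s Y Ns; apply: separable_from_fibre3.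
apply: separable_from_sub (sss _ _ (subsemigroup_over3 s Y) _).
  by move=> x; right.
by case=> // -[_]; exact: Ns.
Qed.

Lemma residually_finite_posnatX (S : semigroupType) :
  residually_finite S -> residually_finite (posnat * S)%type.
Proof.
move=> rf [n s] [m y] neq; apply: separable_from_fibre.
apply: residually_finite_separable => //; last by move=> /= /esym.
by apply: (@sub_finite_set _ _ [set y]) => // a [].
Qed.

Lemma posnatX_residually_finite (S : semigroupType) :
  residually_finite (posnat * S)%type -> residually_finite S.
Proof.
move=> rf s y neq; apply: separable_from_fibre3.
apply: (@separable_from_sub _ _ _ [set (three, y)]).
  by move=> [k a] [/= -> ->].
by apply: rf => -[].
Qed.

Lemma residually_finite_weakly_posnatX (S : semigroupType) :
  residually_finite S -> weakly_subsemigroup_separable (posnat * S)%type.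
Proof.
move=> rf [n s] Y fgY Ns; apply: separable_from_fibre.
by apply: residually_finite_separable => //; exact: finite_fibre_fg.
Qed.

Lemma weakly_posnatX_residually_finite (S : semigroupType) :
  weakly_subsemigroup_separable (posnat * S)%type -> residually_finite S.
Proof.
move=> wss s y neq; apply: separable_from_fibre3.
pose X : set (posnat * S) := [set (three, y)].
apply: (@separable_from_sub _ _ _ (smallest (@subsemigroup _) X)).
  by move=> [k a] [/= -> ->]; exact: sub_gen_smallest.
apply: wss; first by exists X; split=> //; [exact: finite_set1|exists (three, y)].
(* The subsemigroup generated by [(three, y)] meets the fibre over 3 only in [(three, y)], so it
   misses [(three, s)]. *)
move=> /(smallest_sub (subsemigroup_over3 s [set y])) [].
- by move=> _ ->; right.
- by [].
- by move=> [_] /= /esym.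
Qed.

Theorem theorem1p2 (S : semigroupType) (S_nonempty : inhabited S) :
  [/\ completely_separable (posnat * S)%type <-> completely_separable S,
      weakly_subsemigroup_separable (posnat * S)%type /\
        ~ strongly_subsemigroup_separable (posnat * S)%type
      <-> residually_finite S /\ ~ completely_separable S
    & ~ residually_finite (posnat * S)%type <-> ~ residually_finite S].
Proof.
have cs : completely_separable (posnat * S)%type <-> completely_separable S.
  split; last exact: completely_separable_posnatX.
  by move/completely_separable_strongly/strongly_posnatX_completely_separable.
split=> //.
(* The positive halves match through residual finiteness of [S]; the negative ones match because
   strong separability of the product amounts to complete separability of [S]. *)
- split=> -[sep Nsep]; split.
  + exact: weakly_posnatX_residually_finite.
  + by move=> /cs/completely_separable_strongly.
  + exact: residually_finite_weakly_posnatX.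
  + by move/strongly_posnatX_completely_separable.
- split; apply: contra_not; last exact: posnatX_residually_finite.
  exact: residually_finite_posnatX.
Qed.
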